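(* Consider the DRV process with choice function $k(n)$ satisfying $k(n)\to\infty$ and $k(n)=\Omega(\log n)$. Then for every fixed $d\in(0,1)$, with high probability no giant component exists at time $t=\lfloor dn\rfloor$; that is, $C_1(\lfloor dn\rfloor)/n\to 0$ in probability as $n\to\infty$, where $C_1(t)$ is the number of vertices in the largest connected component of the graph after $t$ edges have been added.
   Context: The DRV process (Degree Rule with Varying Choice): fix a function $k=k(n)$ with $2\le k(n)\le n$. Start at time $t=0$ with $n$ isolated vertices and no edges. At each time step $t=0,1,2,\dots$ (one edge is added per step, so after $t$ steps the graph has $t$ edges; multiple edges are allowed), independently of the past choose a set $V_t$ of $k(n)$ distinct vertices uniformly at random, and let $V_{t,d}$ be the set of vertices in $V_t$ whose current degree is $d$. If $|V_{t,0}|\ge 2$, add an edge between two vertices of $V_{t,0}$ sampled uniformly at random without replacement; otherwise, if $|V_{t,1}|\ge 2$, add an edge between two vertices of $V_{t,1}$ sampled uniformly at random without replacement; otherwise add an edge between two vertices of $V_t$ sampled uniformly at random without replacement. The process may be run for any number of steps (including beyond $t=n$). ''With high probability'' (w.h.p.) means with probability tending to $1$ as $n\to\infty$. *)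

(* Defs.v *)
From Stdlib Require Import Reals List Arith ZArith.
Import ListNotations.
Open Scope R_scope.

(** A multigraph on the vertex set {0,...,n-1} is a list of edges
    (the most recently added edge first). *)
Definition graph := list (nat * nat).

Definition degree (E : graph) (v : nat) : nat :=
  fold_right (fun e acc => ((if Nat.eqb (fst e) v then 1 else 0)
                           + (if Nat.eqb (snd e) v then 1 else 0) + acc)%nat) 0%nat E.

Fixpoint subsets (l : list nat) (k : nat) : list (list nat) :=
  match l with
  | [] => match k with O => [[]] | S _ => [] end
  | x :: l' => match k with
               | O => [[]]
               | S k' => map (cons x) (subsets l' k') ++ subsets l' k
               end
  end.

Fixpoint pairs (l : list nat) : list (nat * nat) :=
  match l with
  | [] => []
  | x :: l' => map (fun y => (x, y)) l' ++ pairs l'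
  end.

Definition chosen_set (E : graph) (S : list nat) : list nat :=
  let V0 := filter (fun v => Nat.eqb (degree E v) 0) S in
  if Nat.leb 2 (length V0) then V0 else
  let V1 := filter (fun v => Nat.eqb (degree E v) 1) S in
  if Nat.leb 2 (length V1) then V1 else S.

Definition distr := list (R * graph).

(** One step of the DRV process with n vertices and choice parameter kn:
    V_t uniform among the C(n,kn) kn-subsets, then a uniform unordered
    pair of distinct vertices of the chosen set. *)
Definition drv_step (n kn : nat) (D : distr) : distr :=
  let Ss := subsets (seq 0 n) kn in
  flat_map (fun wE : R * graph =>
     let (w, E) := wE in
     flat_map (fun S : list nat =>
        let P := pairs (chosen_set E S) in
        map (fun p => (w / INR (length Ss) / INR (length P), p :: E)) P) Ss) D.

Fixpoint drv_dist (n kn t : nat) : distr :=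
  match t with
  | O => [(1, [])]
  | S t' => drv_step n kn (drv_dist n kn t')
  end.

Definition drv_prob (n kn t : nat) (P : graph -> bool) : R :=
  fold_right Rplus 0 (map (fun wE => if P (snd wE) then fst wE else 0)
                          (drv_dist n kn t)).

Definition adjb (E : graph) (x y : nat) : bool :=
  existsb (fun e => (Nat.eqb (fst e) x && Nat.eqb (snd e) y)
                    || (Nat.eqb (fst e) y && Nat.eqb (snd e) x))%bool E.

Fixpoint reachb (n : nat) (E : graph) (m v u : nat) : bool :=
  match m with
  | O => Nat.eqb v u
  | S m' => (reachb n E m' v u
             || existsb (fun w => reachb n E m' v w && adjb E w u) (seq 0 n))%bool
  end.

(** size of the connected component of v (paths of length <= n suffice) *)
Definition comp_size (n : nat) (E : graph) (v : nat) : nat :=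
  length (filter (fun u => reachb n E n v u) (seq 0 n)).

Definition largest_comp (n : nat) (E : graph) : nat :=
  fold_right Nat.max 0%nat (map (comp_size n E) (seq 0 n)).

(** floor of a real as a nat (for nonnegative arguments) *)
Definition floorN (x : R) : nat := Z.to_nat (Int_part x).

(* Main.v *)
Require Import Defs.
From Stdlib Require Import Reals List Arith ZArith Lra Lia.
Import ListNotations.
Open Scope R_scope.

(** Call an edge good if it joins two isolated vertices, or joins two leaves at a time when there
    are at least [gam * n] leaves, with [gam = (1 - d) / 2].  The good edges form a graph of maximum
    degree 2, so each of its components has at most two vertices of degree at most 1, and the
    component sizes summed over the current leaves total at most [2 n].  A uniform pair of leaves
    therefore raises the energy (the sum of the squared component sizes of the good graph) by
    [O(1)] on average, so the energy stays [O(n)].  After at most [d n] edges, at least [2 gam n]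
    vertices have degree 0 or 1, so one of these two degrees is frequent; an edge can only be bad if
    the random set holds at most one vertex of the frequent degree, which has probability
    [O(1 / k)].  Finally, a component of the whole graph is covered by the good components of one
    of its vertices and of the ends of bad edges, so
    [K C_1 <= K^2 (2 #bad + 1) + energy] for every [K]; Markov's inequality with [K] a large
    constant concludes. *)

(** * Finite sums over lists and indicators *)

Definition sumf {A : Type} (f : A -> R) (l : list A) : R :=
  fold_right (fun x acc => f x + acc) 0 l.

Definition ind (b : bool) : R := if b then 1 else 0.

Definition count (P : nat -> bool) (l : list nat) : nat := length (filter P l).

Lemma sumf_cons {A} (f : A -> R) x l : sumf f (x :: l) = f x + sumf f l.
Proof. reflexivity. Qed.

Lemma sumf_app {A} (f : A -> R) l l' : sumf f (l ++ l') = sumf f l + sumf f l'.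
Proof. induction l as [|x l IH]; simpl; lra. Qed.

Lemma sumf_map {A B} (f : B -> R) (h : A -> B) l :
  sumf f (map h l) = sumf (fun x => f (h x)) l.
Proof. induction l as [|x l IH]; simpl; lra. Qed.

Lemma sumf_flat_map {A B} (f : B -> R) (h : A -> list B) l :
  sumf f (flat_map h l) = sumf (fun x => sumf f (h x)) l.
Proof. induction l as [|x l IH]; simpl; rewrite ?sumf_app; lra. Qed.

Lemma sumf_ext {A} (f g : A -> R) l :
  (forall x, In x l -> f x = g x) -> sumf f l = sumf g l.
Proof.
  induction l as [|x l IH]; simpl; intros H; [reflexivity|].
  rewrite (H x), IH; auto.
Qed.

Lemma sumf_le {A} (f g : A -> R) l :
  (forall x, In x l -> f x <= g x) -> sumf f l <= sumf g l.
Proof.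
  induction l as [|x l IH]; simpl; intros H; [lra|].
  apply Rplus_le_compat; auto.
Qed.

Lemma sumf_nonneg {A} (f : A -> R) l :
  (forall x, In x l -> 0 <= f x) -> 0 <= sumf f l.
Proof.
  induction l as [|x l IH]; simpl; intros H; [lra|].
  apply Rplus_le_le_0_compat; auto.
Qed.

Lemma sumf_plus {A} (f g : A -> R) l :
  sumf (fun x => f x + g x) l = sumf f l + sumf g l.
Proof. induction l as [|x l IH]; simpl; lra. Qed.

Lemma sumf_scal {A} (c : R) (f : A -> R) l :
  sumf (fun x => c * f x) l = c * sumf f l.
Proof. induction l as [|x l IH]; simpl; rewrite ?IH; ring. Qed.

Lemma sumf_const {A} (c : R) (l : list A) : sumf (fun _ => c) l = c * INR (length l).
Proof.
  induction l as [|x l IH]; [simpl; ring|].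
  change (length (x :: l)) with (S (length l)).
  rewrite S_INR; simpl; rewrite IH; ring.
Qed.

Lemma sumf_exchange {A B} (f : A -> B -> R) l l' :
  sumf (fun x => sumf (f x) l') l = sumf (fun y => sumf (fun x => f x y) l) l'.
Proof.
  induction l as [|x l IH]; simpl.
  - rewrite sumf_const; ring.
  - rewrite IH, <- sumf_plus; reflexivity.
Qed.

Lemma sumf_filter {A} (P : A -> bool) (f : A -> R) l :
  sumf f (filter P l) = sumf (fun x => ind (P x) * f x) l.
Proof.
  induction l as [|x l IH]; simpl; [reflexivity|].
  unfold ind at 1; destruct (P x); simpl; lra.
Qed.

Lemma INR_count (P : nat -> bool) l : INR (count P l) = sumf (fun x => ind (P x)) l.
Proof.
  unfold count.
  rewrite <- (Rmult_1_l (INR _)), <- (sumf_const 1 (filter P l)), sumf_filter.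
  apply sumf_ext; intros; ring.
Qed.

Lemma ind_bounds b : 0 <= ind b <= 1.
Proof. destruct b; simpl; lra. Qed.

(** * Symmetric sums over the [k]-subsets of a list *)

(* Total weight of the subsets of the disjoint union of an [a]-set and a [b]-set,
   a subset with [z] elements in the first and [y] in the second weighing [psi z y]. *)
Fixpoint wsum (a b : nat) (psi : nat -> nat -> R) : R :=
  match a with
  | S a' => wsum a' b (fun z y => psi (S z) y) + wsum a' b psi
  | O => (fix aux b psi := match b with
          | S b' => aux b' (fun z y => psi z (S y)) + aux b' psi
          | O => psi 0%nat 0%nat end) b psi
  end.

(** Pascal's recursion in the second block; it is definitional only when the first block is
    empty. *)
Lemma wsum_Sr a b psi :
  wsum a (S b) psi = wsum a b (fun z y => psi z (S y)) + wsum a b psi.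
Proof.
  revert psi; induction a as [|a IH]; intros psi; [reflexivity|].
  cbn [wsum]; rewrite !IH; ring.
Qed.

Lemma wsum_ext a b psi psi' :
  (forall z y, psi z y = psi' z y) -> wsum a b psi = wsum a b psi'.
Proof.
  revert psi psi'; induction a as [|a IH]; intros psi psi' H.
  - revert psi psi' H; induction b as [|b IHb]; intros psi psi' H; [apply H|].
    rewrite !wsum_Sr; f_equal; apply IHb; auto.
  - simpl; f_equal; apply IH; auto.
Qed.

Lemma wsum_le a b psi psi' :
  (forall z y, psi z y <= psi' z y) -> wsum a b psi <= wsum a b psi'.
Proof.
  revert psi psi'; induction a as [|a IH]; intros psi psi' H.
  - revert psi psi' H; induction b as [|b IHb]; intros psi psi' H; [apply H|].
    rewrite !wsum_Sr; apply Rplus_le_compat; apply IHb; auto.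
  - simpl; apply Rplus_le_compat; apply IH; auto.
Qed.

Lemma wsum_plus a b psi psi' :
  wsum a b (fun z y => psi z y + psi' z y) = wsum a b psi + wsum a b psi'.
Proof.
  revert psi psi'; induction a as [|a IH]; intros psi psi'.
  - revert psi psi'; induction b as [|b IHb]; intros psi psi'; [reflexivity|].
    rewrite !wsum_Sr, !IHb; ring.
  - simpl; rewrite !IH; ring.
Qed.

Lemma wsum_zero a b : wsum a b (fun _ _ => 0) = 0.
Proof.
  induction a as [|a IH]; [|simpl; rewrite IH; ring].
  induction b as [|b IHb]; [reflexivity|rewrite wsum_Sr, IHb; ring].
Qed.

(** Double counting of the pairs formed by a subset and one of its elements in the first block: the
    element can be chosen in [S a] ways, and the rest is a subset avoiding it. *)
Lemma wsum_absorb a b psi :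
  wsum (S a) b (fun z y => INR z * psi z y)
  = INR (S a) * wsum a b (fun z y => psi (S z) y).
Proof.
  assert (step : forall c psi, wsum (S c) b (fun z y => INR z * psi z y)
    = wsum c b (fun z y => INR z * psi (S z) y) + wsum c b (fun z y => psi (S z) y)
      + wsum c b (fun z y => INR z * psi z y)).
  { intros c p; cbn [wsum]; f_equal; rewrite <- wsum_plus.
    apply wsum_ext; intros; rewrite S_INR; ring. }
  assert (base : forall psi, wsum 0 b (fun z y => INR z * psi z y) = 0).
  { clear; induction b as [|b IHb]; intros psi; [simpl; ring|].
    rewrite wsum_Sr, (IHb psi), (IHb (fun z y => psi z (S y))); ring. }
  revert psi; induction a as [|a IH]; intros psi.
  - rewrite step, !base; simpl; ring.
  - rewrite step, (IH psi), (IH (fun z y => psi (S z) y)), (S_INR (S a)).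
    cbn [wsum]; ring.
Qed.

Definition level (k : nat) (phi : nat -> R) (z y : nat) : R :=
  if Nat.eqb (z + y) k then phi z else 0.

(** A weight that depends on a subset only through its number of marked elements sees only how many
    elements of [l] are marked and unmarked. *)
Lemma subsets_sum (P : nat -> bool) l k phi :
  sumf (fun S => phi (count P S)) (subsets l k)
  = wsum (count P l) (count (fun x => negb (P x)) l) (level k phi).
Proof.
  revert k phi; induction l as [|x l IH]; intros k phi.
  - destruct k; simpl; unfold level; simpl; unfold count; simpl; ring.
  - assert (eA : forall S, count P (x :: S) = ((if P x then 1 else 0) + count P S)%nat)
      by (intros S; unfold count; simpl; destruct (P x); reflexivity).
    assert (eB : count (fun x => negb (P x)) (x :: l)
      = ((if P x then 0 else 1) + count (fun x => negb (P x)) l)%nat)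
      by (unfold count; simpl; destruct (P x); reflexivity).
    rewrite eB, (eA l).
    destruct k as [|k].
    + replace (subsets (x :: l) 0) with (subsets l 0) by (destruct l; reflexivity).
      rewrite IH.
      destruct (P x); cbn [plus wsum]; rewrite ?wsum_Sr.
      * replace (wsum _ _ (fun z y => level 0 phi (S z) y)) with 0; [ring|].
        rewrite <- (wsum_zero (count P l) (count (fun x => negb (P x)) l)) at 1.
        reflexivity.
      * replace (wsum _ _ (fun z y => level 0 phi z (S y))) with 0; [ring|].
        rewrite <- (wsum_zero (count P l) (count (fun x => negb (P x)) l)) at 1.
        apply wsum_ext; intros z y; unfold level.
        rewrite Nat.add_succ_r; reflexivity.
    + cbn [subsets]; rewrite sumf_app, sumf_map, IH.
      rewrite (sumf_ext _ (fun S => (fun z => phi ((if P x then 1 else 0) + z)%nat)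
                                     (count P S)))
        by (intros S _; rewrite eA; reflexivity).
      rewrite (IH k (fun z => phi ((if P x then 1 else 0) + z)%nat)).
      destruct (P x); cbn [plus wsum]; rewrite ?wsum_Sr; f_equal.
      apply wsum_ext; intros z y; unfold level.
      rewrite Nat.add_succ_r; reflexivity.
Qed.

(** By symmetry every marked element collects the same weight, that of the subsets containing it;
    removing it explains [count P l - 1] and the shift [S z]. This serves the pairs through the head
    of the list in the version for pairs below. *)
Lemma subsets_sum1 (P : nat -> bool) (g : nat -> R) l k phi :
  sumf (fun S => phi (count P S) * sumf g (filter P S)) (subsets l k)
  = wsum (count P l - 1) (count (fun x => negb (P x)) l)
         (fun z y => level k phi (S z) y) * sumf g (filter P l).
Proof.
  revert k phi; induction l as [|x l IH]; intros k phi.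
  - destruct k; simpl; ring.
  - destruct k as [|k].
    + change (sumf (fun S => phi (count P S) * sumf g (filter P S)) [[]]
        = wsum (count P (x :: l) - 1) (count (fun y => negb (P y)) (x :: l))
            (fun _ _ => 0) * sumf g (filter P (x :: l))).
      rewrite wsum_zero; simpl; ring.
    + cbn [subsets]; rewrite sumf_app, sumf_map, IH.
      unfold count in *; cbn [filter]; destruct (P x) eqn:Px; cbn [negb length].
      * pose (phi1 := fun z => phi (1 + z)%nat).
        rewrite (sumf_ext _ (fun S => g x * phi1 (length (filter P S))
          + phi1 (length (filter P S)) * sumf g (filter P S)))
          by (intros S _; rewrite sumf_cons; unfold phi1; cbn [length plus]; ring).
        rewrite sumf_cons, sumf_plus, sumf_scal, (IH k phi1).
        pose proof (subsets_sum P l k phi1) as E0.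
        unfold count in E0; rewrite E0; clear E0.
        (* If the tail has no marked element, the truncated [count P l - 1] is 0 and Pascal's step
           does not apply, so this case is checked apart. *)
        destruct (filter P l) as [|w l'] eqn:El; cbn [length Nat.sub wsum].
        { simpl sumf. rewrite !Rmult_0_r, !Rplus_0_r, Rmult_comm; reflexivity. }
        rewrite Nat.sub_0_r; unfold phi1, level; cbn [plus Nat.eqb]; ring.
      * rewrite wsum_Sr, IH, Rmult_plus_distr_r; f_equal; f_equal.
        apply wsum_ext; intros z y; unfold level.
        rewrite Nat.add_succ_r; reflexivity.
Qed.

(** Same symmetry for pairs: the common coefficient is the weight of the subsets containing two
    given marked elements. *)
Lemma subsets_sum2 (P : nat -> bool) (g : nat * nat -> R) l k phi :
  sumf (fun S => phi (count P S) * sumf g (pairs (filter P S))) (subsets l k)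
  = wsum (count P l - 2) (count (fun x => negb (P x)) l)
         (fun z y => level k phi (S (S z)) y) * sumf g (pairs (filter P l)).
Proof.
  revert k phi; induction l as [|x l IH]; intros k phi.
  - destruct k; simpl; ring.
  - destruct k as [|k].
    + change (sumf (fun S => phi (count P S) * sumf g (pairs (filter P S))) [[]]
        = wsum (count P (x :: l) - 2) (count (fun y => negb (P y)) (x :: l))
            (fun _ _ => 0) * sumf g (pairs (filter P (x :: l)))).
      rewrite wsum_zero; simpl; ring.
    + cbn [subsets]; rewrite sumf_app, sumf_map, IH.
      unfold count in *; cbn [filter]; destruct (P x) eqn:Px; cbn [negb length pairs].
      * pose (phi1 := fun z => phi (1 + z)%nat).
        rewrite (sumf_ext _ (fun S =>
            phi1 (length (filter P S))
              * sumf (fun y => g (x, y)) (filter P S)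
          + phi1 (length (filter P S)) * sumf g (pairs (filter P S))))
          by (intros S _; unfold phi1; cbn [pairs length plus]; rewrite sumf_app, sumf_map; ring).
        rewrite sumf_plus, (IH k phi1).
        pose proof (subsets_sum1 P (fun y => g (x, y)) l k phi1) as E1.
        unfold count in E1; rewrite E1; clear E1.
        rewrite sumf_app, sumf_map.
        destruct (filter P l) as [|w [|w' l']] eqn:El; cbn [length Nat.sub wsum].
        { simpl; ring. }
        { cbn [pairs map app sumf fold_right].
          rewrite !Rmult_0_r, !Rplus_0_r; f_equal. }
        rewrite Nat.sub_0_r; unfold phi1, level; cbn [plus Nat.eqb]; ring.
      * rewrite wsum_Sr, IH, Rmult_plus_distr_r; f_equal; f_equal.
        apply wsum_ext; intros z y; unfold level.
        rewrite Nat.add_succ_r; reflexivity.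
Qed.

Lemma length_pairs l : INR (length (pairs l)) = INR (length l) * (INR (length l) - 1) / 2.
Proof.
  induction l as [|x l IH]; [simpl; field|].
  cbn [pairs length]; rewrite length_app, length_map, plus_INR, IH, S_INR; field.
Qed.

(* By symmetry, a uniform pair from the random set [S :&: P] is a uniform pair from [P]. *)
Lemma uniform_pair_bound (P : nat -> bool) (g : nat * nat -> R) l k :
  (forall p, 0 <= g p) -> (2 <= count P l)%nat ->
  sumf (fun S => if Nat.leb 2 (count P S)
                 then sumf g (pairs (filter P S)) / INR (length (pairs (filter P S)))
                 else 0) (subsets l k)
  <= INR (length (subsets l k)) * (sumf g (pairs (filter P l))
                                   / INR (length (pairs (filter P l)))).
Proof.
  intros Hg H2.
  (* [phi z] is the reciprocal of the number of pairs among [z] marked elements. *)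
  set (phi := fun z => if Nat.leb 2 z then / (INR z * (INR z - 1) / 2) else 0).
  assert (big : forall z, (2 <= z)%nat -> 0 < INR z * (INR z - 1) / 2).
  { intros z Hz; apply le_INR in Hz; simpl in Hz; nra. }
  rewrite (sumf_ext _ (fun S => phi (count P S) * sumf g (pairs (filter P S)))).
  2:{ intros S _; unfold phi; rewrite length_pairs; fold (count P S).
      destruct (Nat.leb 2 _); [unfold Rdiv at 1; ring|ring]. }
  rewrite subsets_sum2.
  (* The case of constant [g] evaluates the coefficient [w]: times the number of marked pairs in
     [l], it counts the subsets with at least two marked elements. *)
  pose proof (subsets_sum2 P (fun _ => 1) l k phi) as E1.
  set (w := wsum _ _ _) in *.
  rewrite (sumf_const 1 (pairs (filter P l))), Rmult_1_l in E1.
  rewrite length_pairs in *; fold (count P l) in *.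
  assert (Hw : w * (INR (count P l) * (INR (count P l) - 1) / 2)
               <= INR (length (subsets l k))).
  { rewrite <- E1, <- (Rmult_1_l (INR (length (subsets l k)))), <- sumf_const.
    apply sumf_le; intros S _.
    rewrite sumf_const, length_pairs; fold (count P S); unfold phi.
    destruct (Nat.leb_spec 2 (count P S)) as [h|_]; [|lra].
    right; field; apply big in h; split; nra. }
  apply big in H2.
  assert (0 <= sumf g (pairs (filter P l))) by (apply sumf_nonneg; auto).
  apply Rmult_le_reg_r with (1 := H2).
  apply (Rmult_le_compat_l _ _ _ H) in Hw.
  match goal with |- _ <= ?a * (?b / ?c) * ?c => replace (a * (b / c) * c) with (a * b) by (field; nra) end.
  lra.
Qed.

(** * Binomial coefficients and the rarity of sets with at most one marked element *)

Fixpoint bin (n k : nat) : nat :=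
  match k, n with
  | O, _ => 1
  | S _, O => 0
  | S k', S n' => bin n' k' + bin n' k
  end%nat.

Lemma length_subsets l k : length (subsets l k) = bin (length l) k.
Proof.
  revert k; induction l as [|x l IH]; intros [|k]; try reflexivity.
  cbn [subsets length bin]; rewrite length_app, length_map, !IH; reflexivity.
Qed.

Lemma bin_0 n : bin n 0 = 1%nat.
Proof. destruct n; reflexivity. Qed.

Lemma bin_absorb n k : (S k * bin (S n) (S k) = S n * bin n k)%nat.
Proof.
  revert k; induction n as [|n IH]; intros k.
  - destruct k; cbn; lia.
  - change (bin (S (S n)) (S k)) with (bin (S n) k + bin (S n) (S k))%nat.
    destruct k as [|k].
    + pose proof (IH 0%nat) as IH0; rewrite bin_0 in *; lia.
    + pose proof (IH k); pose proof (IH (S k)).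
      change (bin (S n) (S k)) with (bin n k + bin n (S k))%nat in *; lia.
Qed.

Lemma wsum_level_one a b k : wsum a b (level k (fun _ => 1)) = INR (bin (a + b) k).
Proof.
  revert k; induction a as [|a IH]; intros k.
  - revert k; induction b as [|b IHb]; intros k; [destruct k; reflexivity|].
    rewrite wsum_Sr, IHb; destruct k as [|k]; cbn [plus bin].
    + rewrite (wsum_ext _ _ _ (fun _ _ => 0)), wsum_zero; [simpl; destruct b; simpl; ring|].
      intros z y; unfold level; rewrite Nat.add_succ_r; reflexivity.
    + rewrite plus_INR; change b with (0 + b)%nat at 3; rewrite <- (IHb k); f_equal.
      apply wsum_ext; intros z y; unfold level; rewrite Nat.add_succ_r; reflexivity.
  - cbn [wsum]; rewrite IH; destruct k as [|k]; cbn [plus bin].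
    + change (wsum a b (fun _ _ => 0) + INR (bin (a + b) 0) = INR 1).
      rewrite wsum_zero; destruct (a + b)%nat; simpl; ring.
    + rewrite plus_INR, <- (IH k); reflexivity.
Qed.

Lemma count_compl P l : (count P l + count (fun x => negb (P x)) l = length l)%nat.
Proof.
  unfold count; induction l as [|x l IH]; [reflexivity|].
  simpl; destruct (P x); simpl; lia.
Qed.

(* [1{z <= 1} <= 2/(z+1)], and by absorption the mean of [1/(z+1)] is at most
   [(n+1)/((k+1)(a+1))]. *)
Lemma few_marked_bound (P : nat -> bool) l k :
  INR (S k) * INR (S (count P l))
    * sumf (fun S => ind (Nat.leb (count P S) 1)) (subsets l k)
  <= 2 * INR (S (length l)) * INR (length (subsets l k)).
Proof.
  assert (Hs : sumf (fun S => ind (Nat.leb (count P S) 1)) (subsets l k)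
    <= 2 * wsum (count P l) (count (fun x => negb (P x)) l)
                (level k (fun z => / INR (S z)))).
  { rewrite <- subsets_sum, <- sumf_scal; apply sumf_le; intros S _.
    destruct (Nat.leb_spec (count P S) 1) as [h|_].
    - destruct (count P S) as [|[|z]]; simpl; lra || lia.
    - simpl ind. pose proof (Rinv_0_lt_compat _ (lt_0_INR (Datatypes.S (count P S)) ltac:(lia))).
      lra. }
  set (a := count P l) in *; set (b := count (fun x => negb (P x)) l) in *.
  assert (Hw : INR (S a) * wsum a b (level k (fun z => / INR (S z)))
               <= INR (bin (S (length l)) (S k))).
  { rewrite <- (count_compl P l); fold a b.
    change (S (a + b)) with (S a + b)%nat; rewrite <- wsum_level_one.
    (* Read as a shift, [1/(z+1)] is what absorption produces from [z * (1/z)], a weight at most 1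
       on the [S k]-subsets of a set with one more marked element. *)
    change (level k (fun z => / INR (S z)))
      with (fun z y => level (S k) (fun z => / INR z) (S z) y).
    rewrite <- (wsum_absorb a b (level (S k) (fun z => / INR z))).
    apply wsum_le; intros z y; unfold level.
    destruct (Nat.eqb _ _); [|lra].
    (* For [z = 0] the factor [INR z] makes the term 0, so equality with 1 fails but the bound
       holds. *)
    destruct z as [|z]; [simpl; lra|].
    right; apply Rinv_r, not_0_INR; lia. }
  assert (Hb : INR (S k) * INR (bin (S (length l)) (S k))
               = INR (S (length l)) * INR (length (subsets l k))).
  { rewrite length_subsets, <- !mult_INR, bin_absorb; reflexivity. }
  pose proof (pos_INR (S k)); pose proof (pos_INR (S a)).
  apply Rle_trans with (INR (S k) * INR (S a)
     * (2 * wsum a b (level k (fun z => / INR (S z))))).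
  - apply Rmult_le_compat_l; [nra|exact Hs].
  - rewrite Rmult_assoc in *; nra.
Qed.

(** * Partitions given by labels, their energy and their free stubs *)

Definition merge (L : nat -> nat) (u v w : nat) : nat :=
  if Nat.eqb (L w) (L v) then L u else L w.

Definition class_size (n : nat) (L : nat -> nat) (w : nat) : R :=
  sumf (fun x => ind (Nat.eqb (L x) (L w))) (seq 0 n).

(** Each class is counted once per member, which gives the sum of the squared class sizes. *)
Definition energy (n : nat) (L : nat -> nat) : R := sumf (class_size n L) (seq 0 n).

Lemma class_size_nonneg n L w : 0 <= class_size n L w.
Proof. apply sumf_nonneg; intros; apply ind_bounds. Qed.

Lemma energy_nonneg n L : 0 <= energy n L.
Proof. apply sumf_nonneg; intros; apply class_size_nonneg. Qed.

(** [(a + b)^2 - a^2 - b^2 = 2ab] for distinct classes; if [u] and [v] already share a class,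
    merging changes nothing, hence an inequality. *)
Lemma energy_merge n L u v :
  energy n (merge L u v) <= energy n L + 2 * (class_size n L u * class_size n L v).
Proof.
  (* Vertex by vertex: a member of the class of [v] gains at most the class of [u], and
     conversely. *)
  apply Rle_trans with (sumf (fun w => class_size n L w
    + (class_size n L u * ind (Nat.eqb (L w) (L v))
       + class_size n L v * ind (Nat.eqb (L w) (L u)))) (seq 0 n)).
  - apply sumf_le; intros w _; unfold class_size.
    rewrite 2!(Rmult_comm (sumf _ _)), <- 2!sumf_scal, <- 2!sumf_plus.
    apply sumf_le; intros x _; unfold merge.
    destruct (Nat.eqb_spec (L x) (L v)), (Nat.eqb_spec (L w) (L v)),
      (Nat.eqb_spec (L x) (L u)), (Nat.eqb_spec (L w) (L u)),
      (Nat.eqb_spec (L x) (L w)); simpl; try (exfalso; congruence);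
    repeat match goal with |- context [Nat.eqb ?a ?b] =>
      destruct (Nat.eqb_spec a b); simpl; try (exfalso; congruence) end; lra.
  - rewrite 2!sumf_plus, 2!sumf_scal; fold (energy n L).
    fold (class_size n L u) (class_size n L v); lra.
Qed.

Lemma sumf_delta (l : list nat) u (h : nat -> R) :
  NoDup l -> In u l -> sumf (fun x => ind (Nat.eqb x u) * h x) l = h u.
Proof.
  induction l as [|x l IH]; intros Hn Hu; [destruct Hu|].
  inversion Hn as [|? ? Hx Hl]; subst; simpl.
  destruct (Nat.eqb_spec x u) as [->|ne].
  - rewrite (sumf_ext _ (fun _ => 0)), sumf_const; [simpl; ring|].
    intros y Hy; destruct (Nat.eqb_spec y u); [congruence|simpl; ring].
  - destruct Hu as [|Hu]; [congruence|]; rewrite IH by assumption; simpl; ring.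
Qed.

(** Joining two classes with at most two stubs each uses one stub at either end, so at most
    [2 + 2 - 1 - 1] remain. An edge inside a class only consumes stubs. *)
Lemma stubs_merge n L (f : nat -> R) u v :
  In u (seq 0 n) -> In v (seq 0 n) -> (forall w, 0 <= f w) ->
  (forall c, sumf (fun x => ind (Nat.eqb (L x) c) * f x) (seq 0 n) <= 2) ->
  forall c, sumf (fun x => ind (Nat.eqb (merge L u v x) c)
                   * (f x - ind (Nat.eqb x u) - ind (Nat.eqb x v))) (seq 0 n) <= 2.
Proof.
  intros Hu Hv Hf H c.
  destruct (Nat.eq_dec (L u) (L v)) as [e|ne].
  - apply Rle_trans with (2 := H c); apply sumf_le; intros x _.
    assert (merge L u v x = L x) as ->.
    { unfold merge; destruct (Nat.eqb_spec (L x) (L v)); congruence. }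
    apply Rmult_le_compat_l; [apply ind_bounds|].
    pose proof (ind_bounds (Nat.eqb x u)); pose proof (ind_bounds (Nat.eqb x v)); lra.
  - destruct (Nat.eq_dec c (L u)) as [->|nc].
    + rewrite (sumf_ext _ (fun x =>
        (ind (Nat.eqb (L x) (L u)) * f x + ind (Nat.eqb (L x) (L v)) * f x)
        + ((-1) * (ind (Nat.eqb x u) * 1) + (-1) * (ind (Nat.eqb x v) * 1)))).
      2:{ intros x _; unfold merge.
          destruct (Nat.eqb_spec x u), (Nat.eqb_spec x v); subst;
          try (exfalso; congruence); simpl;
          repeat match goal with |- context [Nat.eqb ?a ?b] =>
            destruct (Nat.eqb_spec a b); simpl; try (exfalso; congruence) end; ring. }
      rewrite 3!sumf_plus, 2!sumf_scal, !(sumf_delta _ _ (fun _ => 1)) by (auto using seq_NoDup).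
      pose proof (H (L u)); pose proof (H (L v)); lra.
    (* A label other than [L u] either keeps its class or, if it is [L v], loses it entirely. *)
    + apply Rle_trans with (2 := H c); apply sumf_le; intros x _.
      unfold merge; pose proof (ind_bounds (Nat.eqb x u)); pose proof (ind_bounds (Nat.eqb x v)).
      pose proof (Hf x).
      destruct (Nat.eqb_spec (L x) (L v)).
      * destruct (Nat.eqb_spec (L u) c); [congruence|].
        destruct (Nat.eqb (L x) c); simpl; lra.
      * destruct (Nat.eqb (L x) c); simpl; lra.
Qed.

(** * The graph of good edges and its invariants *)

Definition has_degree (j : nat) (E : graph) (v : nat) : bool := Nat.eqb (degree E v) j.

Definition many_leaves (n : nat) (th : R) (E : graph) : bool :=
  if Rle_dec th (INR (count (has_degree 1 E) (seq 0 n))) then true else false.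

Definition good (n : nat) (th : R) (E : graph) (p : nat * nat) : bool :=
  ((has_degree 0 E (fst p) && has_degree 0 E (snd p))
   || (has_degree 1 E (fst p) && has_degree 1 E (snd p) && many_leaves n th E))%bool.

(** Component labels of the good graph. As the newest edge comes first, each edge is tested against
    the graph [E'] to which it was added. *)
Fixpoint lab (n : nat) (th : R) (E : graph) : nat -> nat :=
  match E with
  | [] => fun w => w
  | p :: E' => if good n th E' p then merge (lab n th E') (fst p) (snd p) else lab n th E'
  end.

(* In the good graph, which has maximum degree 2, [stubs n th E w] is [2 - degree w]. *)
Fixpoint stubs (n : nat) (th : R) (E : graph) (w : nat) : R :=
  match E with
  | [] => 2
  | p :: E' => if good n th E' p
               then stubs n th E' w - ind (Nat.eqb w (fst p)) - ind (Nat.eqb w (snd p))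
               else stubs n th E' w
  end.

Fixpoint bad_ends (n : nat) (th : R) (E : graph) : list nat :=
  match E with
  | [] => []
  | p :: E' => if good n th E' p then bad_ends n th E'
               else fst p :: snd p :: bad_ends n th E'
  end.

(** In order: the degree in the good graph is at most 2 and at most the true degree; a component has
    at most two free stubs; an isolated vertex is alone in its class. The name is loose, since a
    good edge may close a path into a cycle, which then has no stubs. *)
Definition linear_forest (n : nat) (th : R) (E : graph) : Prop :=
  (forall w, 0 <= stubs n th E w /\ 2 - INR (degree E w) <= stubs n th E w)
  /\ (forall c, sumf (fun x => ind (Nat.eqb (lab n th E x) c) * stubs n th E x) (seq 0 n) <= 2)
  /\ (forall x w, degree E x = 0%nat -> lab n th E w = lab n th E x -> w = x).

Lemma linear_forest_nil n th : linear_forest n th [].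
Proof.
  split; [|split].
  - intros w; simpl; lra.
  - intros c; simpl.
    destruct (in_dec Nat.eq_dec c (seq 0 n)) as [Hc|Hc].
    + rewrite (sumf_delta _ c (fun _ => 2)); auto using seq_NoDup; lra.
    + rewrite (sumf_ext _ (fun _ => 0)), sumf_const; [lra|].
      intros x Hx; destruct (Nat.eqb_spec x c); [congruence|simpl; ring].
  - auto.
Qed.

Lemma good_degree n th E p : good n th E p = true ->
  (degree E (fst p) <= 1)%nat /\ (degree E (snd p) <= 1)%nat.
Proof.
  unfold good, has_degree; intros H.
  apply Bool.orb_true_iff in H; rewrite !Bool.andb_true_iff, !Nat.eqb_eq in H; lia.
Qed.

(** The ends of a good edge have degree at most 1, hence each has a stub to spend. A bad edge leaves
    labels and stubs alone and only raises degrees. *)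
Lemma linear_forest_cons n th E u v :
  In u (seq 0 n) -> In v (seq 0 n) -> u <> v ->
  linear_forest n th E -> linear_forest n th ((u, v) :: E).
Proof.
  intros Hu Hv Huv (H1 & H2 & H3).
  unfold linear_forest; cbn [stubs lab].
  destruct (good n th E (u, v)) eqn:G; cbn [fst snd].
  - apply good_degree in G as [Gu Gv]; cbn [fst snd] in Gu, Gv.
    split; [|split].
    + intros w; destruct (H1 w) as [Hw Hw']; cbn [degree fold_right fst snd].
      fold (degree E w); rewrite !(Nat.eqb_sym _ w).
      apply le_INR in Gu, Gv; simpl in Gu, Gv.
      destruct (Nat.eqb_spec w u), (Nat.eqb_spec w v);
        try congruence; try subst w; cbn [plus ind]; rewrite ?S_INR; lra.
    + apply stubs_merge; auto; apply H1.
    (* A vertex still isolated is neither [u] nor [v] and was alone in its class, so the merge does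
       not touch that class. *)
    + intros x w; cbn [degree fold_right fst snd]; fold (degree E x).
      destruct (Nat.eqb_spec u x), (Nat.eqb_spec v x); try (intros; lia).
      cbn [plus]; intros Dx; unfold merge.
      destruct (Nat.eqb_spec (lab n th E x) (lab n th E v)) as [e|_].
      { apply eq_sym, H3 in e; congruence. }
      destruct (Nat.eqb (lab n th E w) (lab n th E v)); intros e; apply H3 in e; auto; congruence.
  - split; [|split]; auto.
    + intros w; destruct (H1 w) as [Hw Hw']; split; [auto|].
      apply Rle_trans with (2 := Hw'); cbn [degree fold_right fst snd].
      fold (degree E w); rewrite !plus_INR.
      pose proof (pos_INR (if Nat.eqb u w then 1 else 0)).
      pose proof (pos_INR (if Nat.eqb v w then 1 else 0)); lra.
    + intros x w Hx; apply H3; cbn [degree fold_right] in Hx; fold (degree E x) in Hx; lia.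
Qed.

(** A leaf has at least one free stub, so the sum is at most the stub count over all pairs of
    vertices in a common class; after exchanging the sums, each vertex sees at most the two stubs of
    its class. *)
Lemma leaf_class_size n th E : linear_forest n th E ->
  sumf (class_size n (lab n th E)) (filter (has_degree 1 E) (seq 0 n)) <= 2 * INR n.
Proof.
  intros (H1 & H2 & _); rewrite sumf_filter.
  apply Rle_trans with (sumf (fun w => sumf (fun x =>
     ind (Nat.eqb (lab n th E w) (lab n th E x)) * stubs n th E w) (seq 0 n)) (seq 0 n)).
  - apply sumf_le; intros w _; unfold class_size; rewrite <- sumf_scal.
    apply sumf_le; intros x _; rewrite Nat.eqb_sym, Rmult_comm.
    apply Rmult_le_compat_l; [apply ind_bounds|].
    destruct (H1 w) as [Hw Hw']; unfold has_degree.
    destruct (Nat.eqb_spec (degree E w) 1) as [e|_]; simpl; [|exact Hw].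
    rewrite e in Hw'; simpl in Hw'; lra.
  - rewrite sumf_exchange.
    replace (2 * INR n) with (sumf (fun _ => 2) (seq 0 n))
      by (rewrite sumf_const, length_seq; reflexivity).
    apply sumf_le; intros x _; apply H2.
Qed.

Lemma isolated_class_size n th E x : linear_forest n th E -> degree E x = 0%nat ->
  In x (seq 0 n) -> class_size n (lab n th E) x = 1.
Proof.
  intros (_ & _ & H3) Dx Hx; unfold class_size.
  rewrite <- (sumf_delta (seq 0 n) x (fun _ => 1)) by auto using seq_NoDup.
  apply sumf_ext; intros w _.
  destruct (Nat.eqb_spec (lab n th E w) (lab n th E x)) as [e|ne], (Nat.eqb_spec w x);
    subst; simpl; try lra; exfalso; auto.
Qed.

(** A good edge equalizes the labels of its ends, and later merges never separate equal labels. *)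
Lemma edge_lab n th E x y : In (x, y) E ->
  lab n th E x = lab n th E y \/ (In x (bad_ends n th E) /\ In y (bad_ends n th E)).
Proof.
  induction E as [|[u v] E IH]; [intros []|]; cbn [lab bad_ends In].
  destruct (good n th E (u, v)); cbn [fst snd In].
  - intros [[= -> ->]|H].
    + left; unfold merge; rewrite Nat.eqb_refl.
      destruct (Nat.eqb _ _); reflexivity.
    + destruct (IH H) as [e|]; [left; unfold merge; rewrite e; reflexivity|auto].
  - intros [[= -> ->]|H]; [auto|].
    destruct (IH H) as [e|[]]; auto.
Qed.

(** Along a walk the label can change only across an edge whose ends are both in [bad_ends]; the
    vertex just reached is then its own witness. *)
Lemma reach_lab n th E m v u : reachb n E m v u = true ->
  exists t, In t (v :: bad_ends n th E) /\ lab n th E u = lab n th E t.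
Proof.
  revert u; induction m as [|m IH]; intros u; cbn [reachb].
  - intros e; apply Nat.eqb_eq in e; subst; exists u; simpl; auto.
  - intros H; apply Bool.orb_true_iff in H as [H|H]; [auto|].
    apply existsb_exists in H as (w & _ & H).
    apply Bool.andb_true_iff in H as [Hw Ha].
    destruct (IH w Hw) as (t & Ht & e).
    apply existsb_exists in Ha as ([x y] & Hxy & Ha); cbn [fst snd] in Ha.
    rewrite Bool.orb_true_iff, !Bool.andb_true_iff, !Nat.eqb_eq in Ha.
    destruct (edge_lab n th E x y Hxy) as [e'|[Bx By]].
    + exists t; split; [auto|]; destruct Ha as [[-> ->]|[-> ->]]; congruence.
    + exists u; split; [right|reflexivity]; destruct Ha as [[-> ->]|[-> ->]]; auto.
Qed.

(** * The potential dominates the largest component *)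

(** [bad_ends] has two entries per bad edge; the successor accounts for the vertex from which a
    component is explored. *)
Definition potential (n : nat) (th K : R) (E : graph) : R :=
  K * K * INR (S (length (bad_ends n th E))) + energy n (lab n th E).

(* A component is a union of classes of [v] and of the endpoints of bad edges: classes of size
   at most [K] contribute [K] each, and a vertex [u] of a larger class is paid by its share
   [class_size u > K] of the energy. *)
Lemma comp_size_potential n th K E v : 0 <= K ->
  K * INR (comp_size n E v) <= potential n th K E.
Proof.
  intros HK; unfold comp_size, potential.
  fold (count (fun u => reachb n E n v u) (seq 0 n)); rewrite INR_count, <- sumf_scal.
  set (L := lab n th E); set (T := v :: bad_ends n th E).
  set (small := fun u => if Rle_dec (class_size n L u) K then 1 else 0).
  apply Rle_trans with (sumf (fun u =>
    sumf (fun t => K * (ind (Nat.eqb (L u) (L t)) * small u)) T + class_size n L u) (seq 0 n)).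
  - apply sumf_le; intros u _.
    assert (Hpos : forall l, 0 <= sumf (fun t => K * (ind (Nat.eqb (L u) (L t)) * small u)) l).
    { intros l; apply sumf_nonneg; intros t _; unfold small.
      pose proof (ind_bounds (Nat.eqb (L u) (L t))).
      destruct (Rle_dec _ _); nra. }
    pose proof (Hpos T); pose proof (class_size_nonneg n L u).
    destruct (reachb n E n v u) eqn:Hr; simpl ind; [|lra].
    destruct (Rle_dec (class_size n L u) K) as [h|h]; [|lra].
    apply (reach_lab n th) in Hr as (t & Ht & e); fold T L in Ht, e.
    apply in_split in Ht as (l1 & l2 & ->).
    rewrite sumf_app, sumf_cons, e, Nat.eqb_refl.
    pose proof (Hpos l1) as P1; pose proof (Hpos l2) as P2; rewrite e in P1, P2.
    unfold small in *; destruct (Rle_dec (class_size n L u) K); [simpl ind in *; lra|lra].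
  - rewrite sumf_plus; apply Rplus_le_compat_r.
    rewrite sumf_exchange.
    replace (K * K * INR (S (length (bad_ends n th E)))) with (sumf (fun _ => K * K) T)
      by (rewrite sumf_const; reflexivity).
    apply sumf_le; intros t _; rewrite sumf_scal; apply Rmult_le_compat_l; [exact HK|].
    destruct (Rle_dec (class_size n L t) K) as [h|h].
    + apply Rle_trans with (2 := h), sumf_le; intros u _; unfold small.
      pose proof (ind_bounds (Nat.eqb (L u) (L t))); destruct (Rle_dec _ _); lra.
    (* The class of [t] exceeds [K], so none of its members is small. *)
    + rewrite (sumf_ext _ (fun _ => 0)), sumf_const; [lra|].
      intros u _; unfold small.
      destruct (Nat.eqb_spec (L u) (L t)) as [e|]; [|simpl; ring].
      destruct (Rle_dec (class_size n L u) K) as [h'|]; [|simpl; ring].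
      exfalso; apply h; unfold class_size in *; rewrite <- e; exact h'.
Qed.

Lemma largest_comp_potential n th K E : 0 <= K ->
  K * INR (largest_comp n E) <= potential n th K E.
Proof.
  intros HK; unfold largest_comp; induction (seq 0 n) as [|v l IH]; cbn [map fold_right].
  - unfold potential; pose proof (energy_nonneg n (lab n th E)).
    pose proof (pos_INR (S (length (bad_ends n th E)))); simpl (INR 0).
    assert (0 <= K * K) by nra; nra.
  - destruct (Nat.max_spec (comp_size n E v) (fold_right Nat.max 0%nat (map (comp_size n E) l)))
      as [[_ ->]|[_ ->]]; [exact IH|apply comp_size_potential, HK].
Qed.

(** Every degree [D] satisfies [1 <= [D = 0] + [D = 1] + D/2]; sum this over the vertices and bound
    the degree sum by twice the number of edges. *)
Lemma low_degree_count n E :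
  INR n <= INR (count (has_degree 0 E) (seq 0 n)) + INR (count (has_degree 1 E) (seq 0 n))
           + INR (length E).
Proof.
  assert (Hs : sumf (fun v => INR (degree E v)) (seq 0 n) <= 2 * INR (length E)).
  { induction E as [|[u v] E IH].
    - simpl; rewrite sumf_const; lra.
    - rewrite (sumf_ext _ (fun x => (ind (Nat.eqb x u) * 1 + ind (Nat.eqb x v) * 1)
                                    + INR (degree E x))).
      2:{ intros x _; cbn [degree fold_right fst snd]; fold (degree E x).
          rewrite !plus_INR, !(Nat.eqb_sym _ x).
          destruct (Nat.eqb x u), (Nat.eqb x v); simpl; ring. }
      assert (Hd : forall w, sumf (fun x => ind (Nat.eqb x w) * 1) (seq 0 n) <= 1).
      { intros w; destruct (in_dec Nat.eq_dec w (seq 0 n)) as [Hw|Hw].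
        - rewrite (sumf_delta _ w (fun _ => 1)); auto using seq_NoDup; lra.
        - rewrite (sumf_ext _ (fun _ => 0)), sumf_const; [lra|].
          intros x Hx; destruct (Nat.eqb_spec x w); [congruence|simpl; ring]. }
      rewrite 2!sumf_plus; cbn [length]; rewrite S_INR.
      pose proof (Hd u); pose proof (Hd v); lra. }
  rewrite !INR_count, <- sumf_plus.
  replace (INR n) with (sumf (fun _ => 1) (seq 0 n))
    by (rewrite sumf_const, length_seq; ring).
  apply Rle_trans with (sumf (fun v => (ind (has_degree 0 E v) + ind (has_degree 1 E v))
                                       + / 2 * INR (degree E v)) (seq 0 n)).
  - apply sumf_le; intros v _; unfold has_degree.
    destruct (degree E v) as [|[|j]]; [simpl; lra..|].
    pose proof (pos_INR j); rewrite !S_INR; simpl ind; lra.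
  - rewrite sumf_plus, sumf_scal; lra.
Qed.

(** * Uniform averages *)

(** The value on the empty list is 0, so a constant is only bounded by itself, and only if it is
    nonnegative. *)
Definition mean {A : Type} (f : A -> R) (l : list A) : R := sumf f l / INR (length l).

Lemma mean_const_le {A} (c : R) (l : list A) : 0 <= c -> mean (fun _ => c) l <= c.
Proof.
  intros Hc; unfold mean; rewrite sumf_const; destruct l as [|x l].
  - simpl; unfold Rdiv; rewrite Rmult_0_r, Rmult_0_l; exact Hc.
  - right; field; apply not_0_INR; discriminate.
Qed.

Lemma mean_le {A} (f g : A -> R) l :
  (forall x, In x l -> f x <= g x) -> mean f l <= mean g l.
Proof.
  intros H; unfold mean, Rdiv; apply Rmult_le_compat_r; [|apply sumf_le, H].
  destruct l as [|x l]; [simpl; rewrite Rinv_0; lra|].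
  left; apply Rinv_0_lt_compat, lt_0_INR; simpl; lia.
Qed.

Lemma mean_plus {A} (f g : A -> R) l : mean (fun x => f x + g x) l = mean f l + mean g l.
Proof. unfold mean; rewrite sumf_plus; apply Rdiv_plus_distr. Qed.

Lemma mean_scal {A} (c : R) (f : A -> R) l : mean (fun x => c * f x) l = c * mean f l.
Proof. unfold mean; rewrite sumf_scal; unfold Rdiv; ring. Qed.

Lemma mean_le_const {A} (f : A -> R) c l :
  0 <= c -> (forall x, In x l -> f x <= c) -> mean f l <= c.
Proof.
  intros Hc H; apply Rle_trans with (2 := mean_const_le c l Hc); apply mean_le, H.
Qed.

Lemma mean_le_ratio {A} (f : A -> R) c l :
  0 <= c -> sumf f l <= c * INR (length l) -> mean f l <= c.
Proof.
  intros Hc H; apply Rle_trans with (2 := mean_const_le c l Hc).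
  unfold mean, Rdiv; rewrite sumf_const; apply Rmult_le_compat_r; [|exact H].
  destruct l as [|x l]; [simpl; rewrite Rinv_0; lra|].
  left; apply Rinv_0_lt_compat, lt_0_INR; simpl; lia.
Qed.

(** * Pairs and sets that the process can choose *)

Lemma in_pairs l p : In p (pairs l) -> In (fst p) l /\ In (snd p) l.
Proof.
  induction l as [|x l IH]; [intros []|]; cbn [pairs].
  intros H; apply in_app_or in H as [H|H].
  - apply in_map_iff in H as (y & <- & Hy); simpl; auto.
  - apply IH in H; simpl; tauto.
Qed.

Lemma in_pairs_neq l p : NoDup l -> In p (pairs l) -> fst p <> snd p.
Proof.
  induction l as [|x l IH]; intros Hn; [intros []|]; cbn [pairs].
  inversion Hn; subst; intros H; apply in_app_or in H as [H|H]; auto.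
  apply in_map_iff in H as (y & <- & Hy); simpl; congruence.
Qed.

Lemma in_pairs_count (P : nat -> bool) l p : In p (pairs l) ->
  P (fst p) = true -> P (snd p) = true -> (2 <= count P l)%nat.
Proof.
  unfold count; induction l as [|x l IH]; [intros []|]; cbn [pairs filter].
  intros H H1 H2; apply in_app_or in H as [H|H].
  - apply in_map_iff in H as (y & <- & Hy); simpl in H1, H2.
    assert (In y (filter P l)) by (apply filter_In; auto).
    rewrite H1; simpl; destruct (filter P l); simpl in *; [tauto|lia].
  - specialize (IH H H1 H2); destruct (P x); simpl; lia.
Qed.

(** The square of a sum is its off-diagonal part plus the diagonal squares, which are dropped. *)
Lemma sumf_pairs_mult (h : nat -> R) l :
  sumf (fun p => 2 * (h (fst p) * h (snd p))) (pairs l) <= sumf h l * sumf h l.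
Proof.
  induction l as [|x l IH]; [simpl; lra|]; cbn [pairs].
  rewrite sumf_app, sumf_map, sumf_cons; cbn [fst snd].
  rewrite (sumf_ext _ (fun y => (2 * h x) * h y)), sumf_scal by (intros; ring).
  pose proof (Rle_0_sqr (h x)) as H; unfold Rsqr in H; lra.
Qed.

Lemma in_subsets l k S : In S (subsets l k) -> incl S l /\ (NoDup l -> NoDup S).
Proof.
  revert k S; induction l as [|x l IH]; intros k S H.
  - destruct k; simpl in H; [|tauto]; destruct H as [<-|[]].
    split; [intros ? []|auto].
  - destruct k as [|k]; cbn [subsets] in H.
    { destruct H as [<-|[]]; split; [intros ? []|constructor]. }
    apply in_app_or in H as [H|H].
    + apply in_map_iff in H as (S' & <- & HS); apply IH in HS as [Hi Hn].
      split; [intros y [->|Hy]; simpl; auto|].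
      intros N; inversion N; subst; constructor; auto.
    + apply IH in H as [Hi Hn]; split; [intros y Hy; simpl; auto|].
      intros N; inversion N; auto.
Qed.

Lemma in_chosen_set E S : incl (chosen_set E S) S /\ (NoDup S -> NoDup (chosen_set E S)).
Proof.
  unfold chosen_set; repeat destruct (Nat.leb 2 _);
    split; auto using incl_refl, NoDup_filter; apply incl_filter.
Qed.

Lemma in_pairs_chosen n k E S p :
  In S (subsets (seq 0 n) k) -> In p (pairs (chosen_set E S)) ->
  In (fst p) (seq 0 n) /\ In (snd p) (seq 0 n) /\ fst p <> snd p.
Proof.
  intros HS Hp; destruct (in_subsets _ _ _ HS) as [Hi Hn].
  destruct (in_chosen_set E S) as [Hi' Hn'].
  pose proof (in_pairs _ _ Hp) as [H1 H2].
  split; [|split]; auto.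
  apply (in_pairs_neq _ _ (Hn' (Hn (seq_NoDup _ _))) Hp).
Qed.

(** * Expected increase of the potential in one step *)

Lemma potential_nonneg n th K E : 0 <= potential n th K E.
Proof.
  unfold potential; pose proof (energy_nonneg n (lab n th E)).
  pose proof (pos_INR (S (length (bad_ends n th E)))).
  pose proof (Rle_0_sqr K) as HK; unfold Rsqr in HK; nra.
Qed.

Lemma potential_good n th K E p : good n th E p = true ->
  potential n th K (p :: E) <= potential n th K E
    + 2 * (class_size n (lab n th E) (fst p) * class_size n (lab n th E) (snd p)).
Proof.
  intros G; unfold potential; cbn [lab bad_ends]; rewrite G.
  pose proof (energy_merge n (lab n th E) (fst p) (snd p)); lra.
Qed.

Lemma potential_bad n th K E p : good n th E p = false ->
  potential n th K (p :: E) = potential n th K E + 2 * (K * K).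
Proof.
  intros G; unfold potential; cbn [lab bad_ends length]; rewrite G.
  cbn [length]; rewrite (S_INR (S _)), (S_INR (S (length _))); ring.
Qed.

Definition frequent (n : nat) (th : R) (E : graph) : nat -> bool :=
  has_degree (if many_leaves n th E then 1 else 0) E.

Definition leaf_gain (n : nat) (th : R) (E : graph) (p : nat * nat) : R :=
  2 * (class_size n (lab n th E) (fst p) * class_size n (lab n th E) (snd p)).

(** Follows the rule for a fixed set [S]: an isolated pair costs at most 2, a leaf pair among many
    leaves costs its gain, and a bad edge costs [K * K] per end and forces [S] to hold at most one
    frequent vertex. *)
Lemma potential_mean_pair n th K k E S :
  linear_forest n th E -> In S (subsets (seq 0 n) k) ->
  mean (fun p => potential n th K (p :: E)) (pairs (chosen_set E S))
  <= potential n th K E + 2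
     + 2 * (K * K) * ind (Nat.leb (count (frequent n th E) S) 1)
     + ind (many_leaves n th E) *
       (if Nat.leb 2 (count (has_degree 1 E) S)
        then mean (leaf_gain n th E) (pairs (filter (has_degree 1 E) S)) else 0).
Proof.
  intros HF HS.
  pose proof (potential_nonneg n th K E) as HP.
  assert (HK : 0 <= K * K) by (pose proof (Rle_0_sqr K); unfold Rsqr in *; lra).
  assert (Hin : forall p, In p (pairs (chosen_set E S)) ->
                 In (fst p) (seq 0 n) /\ In (snd p) (seq 0 n))
    by (intros p Hp; apply (in_pairs_chosen n k) in Hp; tauto).
  assert (Hgain : forall l, 0 <= mean (leaf_gain n th E) l).
  { intros l; apply Rle_trans with (mean (fun _ => 0) l).
    - unfold mean; rewrite sumf_const; unfold Rdiv; lra.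
    - apply mean_le; intros p _; unfold leaf_gain.
      pose proof (class_size_nonneg n (lab n th E) (fst p)).
      pose proof (class_size_nonneg n (lab n th E) (snd p)); nra. }
  assert (Hind : forall b, 0 <= 2 * (K * K) * ind b)
    by (intros b; pose proof (ind_bounds b); nra).
  assert (Hmean : forall b, 0 <= ind b * (if Nat.leb 2 (count (has_degree 1 E) S)
     then mean (leaf_gain n th E) (pairs (filter (has_degree 1 E) S)) else 0)).
  { intros b; apply Rmult_le_pos; [apply ind_bounds|].
    destruct (Nat.leb _ _); [apply Hgain|lra]. }
  unfold chosen_set in *; fold (has_degree 0 E) (has_degree 1 E) in *.
  fold (count (has_degree 0 E) S) (count (has_degree 1 E) S) in *.
  destruct (Nat.leb_spec 2 (count (has_degree 0 E) S)) as [h0|h0].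
  { apply Rle_trans with (potential n th K E + 2);
      [|specialize (Hmean (many_leaves n th E));
        specialize (Hind (Nat.leb (count (frequent n th E) S) 1)); lra].
    apply mean_le_const; [lra|]; intros p Hp.
    assert (Hd : has_degree 0 E (fst p) = true /\ has_degree 0 E (snd p) = true).
    { apply in_pairs in Hp as [H1 H2]; apply filter_In in H1, H2; tauto. }
    destruct Hd as [D1 D2].
    apply Rle_trans with (1 := potential_good n th K E p
      ltac:(unfold good; rewrite D1, D2; reflexivity)).
    apply Nat.eqb_eq in D1, D2; destruct (Hin p Hp).
    rewrite !isolated_class_size by auto; lra. }
  destruct (Nat.leb_spec 2 (count (has_degree 1 E) S)) as [h1|h1].
  - assert (Hd : forall p, In p (pairs (filter (has_degree 1 E) S)) ->
       has_degree 1 E (fst p) = true /\ has_degree 1 E (snd p) = true).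
    { intros p Hp; apply in_pairs in Hp as [H1 H2]; apply filter_In in H1, H2; tauto. }
    destruct (many_leaves n th E) eqn:ML.
    + apply Rle_trans with (mean (fun p => potential n th K E + leaf_gain n th E p)
                              (pairs (filter (has_degree 1 E) S))).
      * apply mean_le; intros p Hp; destruct (Hd p Hp) as [D1 D2].
        apply potential_good; unfold good; rewrite D1, D2, ML.
        apply Bool.orb_true_r.
      * rewrite mean_plus; simpl ind.
        pose proof (mean_const_le (potential n th K E)
                      (pairs (filter (has_degree 1 E) S)) HP).
        specialize (Hind (Nat.leb (count (frequent n th E) S) 1)); lra.
    (* With few leaves the frequent degree is 0, and [h0] says that [S] has at most one isolated
       vertex. *)
    + unfold frequent; rewrite ML.
      rewrite (proj2 (Nat.leb_le _ 1)) by lia; simpl ind.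
      apply mean_le_const; [lra|]; intros p Hp; destruct (Hd p Hp) as [D1 D2].
      rewrite potential_bad; [lra|]; unfold good; rewrite ML, Bool.andb_false_r.
      unfold has_degree in *; apply Nat.eqb_eq in D1; rewrite D1; reflexivity.
  (* Both tests failed, so either degree occurs at most once in [S] and no pair from [S] can be
     good. *)
  - assert (hA : (count (frequent n th E) S <= 1)%nat)
      by (unfold frequent; destruct (many_leaves n th E); lia).
    rewrite (proj2 (Nat.leb_le _ 1) hA); simpl ind.
    apply Rle_trans with (potential n th K E + 2 * (K * K)); [|lra].
    apply mean_le_const; [lra|]; intros p Hp.
    rewrite potential_bad; [lra|]; unfold good.
    destruct (has_degree 0 E (fst p)) eqn:a0, (has_degree 0 E (snd p)) eqn:b0,
      (has_degree 1 E (fst p)) eqn:a1, (has_degree 1 E (snd p)) eqn:b1; try reflexivity;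
    first [ pose proof (in_pairs_count _ _ _ Hp a0 b0); lia
          | pose proof (in_pairs_count _ _ _ Hp a1 b1); lia ].
Qed.

Lemma potential_mean_step n gam K k E :
  0 < gam <= 1 -> 2 <= gam * INR n -> 2 * (gam * INR n) + INR (length E) <= INR n ->
  linear_forest n (gam * INR n) E ->
  mean (fun S => mean (fun p => potential n (gam * INR n) K (p :: E)) (pairs (chosen_set E S)))
       (subsets (seq 0 n) k)
  <= potential n (gam * INR n) K E
     + (2 + 4 * (K * K) / (gam * INR (S k)) + 16 / (gam * gam)).
Proof.
  intros Hg Hth Ht HF; set (th := gam * INR n) in *.
  assert (Eth : th = gam * INR n) by reflexivity.
  pose proof (potential_nonneg n th K E) as HP.
  assert (HK : 0 <= K * K) by (pose proof (Rle_0_sqr K); unfold Rsqr in *; lra).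
  assert (Hk : 0 < INR (S k)) by (apply lt_0_INR; lia).
  assert (Hn : 0 < INR n) by (unfold th in *; nra).
  (* At least [2 * th] vertices have degree 0 or 1; if fewer than [th] are leaves, more than [th]
     are isolated. *)
  assert (Hcard : th <= INR (count (frequent n th E) (seq 0 n))).
  { unfold frequent, many_leaves in *.
    pose proof (low_degree_count n E).
    destruct (Rle_dec th (INR (count (has_degree 1 E) (seq 0 n)))); lra. }
  (* The ratio [(n + 1) / (count + 1)] is at most [1 / gam], since [gam <= 1] and the count is at
     least [gam * n]. *)
  assert (Hfew : mean (fun S => ind (Nat.leb (count (frequent n th E) S) 1))
                   (subsets (seq 0 n) k) <= 2 / (gam * INR (S k))).
  { apply mean_le_ratio; [apply Rlt_le, Rdiv_lt_0_compat; nra|].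
    pose proof (few_marked_bound (frequent n th E) (seq 0 n) k) as HB.
    rewrite length_seq in HB.
    set (X := sumf _ _) in *; set (N := INR (length (subsets _ _))) in *.
    assert (HX : 0 <= X) by (apply sumf_nonneg; intros; apply ind_bounds).
    assert (HN : 0 <= N) by apply pos_INR.
    apply Rmult_le_reg_l with (gam * INR (S k)); [nra|].
    replace (gam * INR (S k) * (2 / (gam * INR (S k)) * N)) with (2 * N) by (field; lra).
    apply Rmult_le_reg_l with (INR (S n)); [apply lt_0_INR; lia|].
    apply Rle_trans with (INR (S k) * INR (S (count (frequent n th E) (seq 0 n))) * X); [|lra].
    replace (INR (S n) * (gam * INR (S k) * X)) with (INR (S k) * (INR (S n) * gam) * X) by ring.
    apply Rmult_le_compat_r; [exact HX|]; apply Rmult_le_compat_l; [lra|].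
    rewrite !S_INR; lra. }
  (* The mean gain is at most [(2n)^2] over the number of leaf pairs, and with [a >= th >= 2] leaves
     there are [a(a-1)/2 >= th^2/4] pairs; this yields 16. *)
  assert (Hleaf : ind (many_leaves n th E) *
    mean (fun S => if Nat.leb 2 (count (has_degree 1 E) S)
        then mean (leaf_gain n th E) (pairs (filter (has_degree 1 E) S)) else 0)
      (subsets (seq 0 n) k) <= 16 / (gam * gam)).
  { assert (0 < 16 / (gam * gam)) by (apply Rdiv_lt_0_compat; nra).
    unfold frequent in Hcard.
    destruct (many_leaves n th E); simpl ind; [|lra].
    rewrite Rmult_1_l; apply mean_le_ratio; [lra|].
    assert (H2 : (2 <= count (has_degree 1 E) (seq 0 n))%nat)
      by (apply INR_le; simpl; lra).
    assert (Hpos : forall p, 0 <= leaf_gain n th E p).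
    { intros p; unfold leaf_gain.
      pose proof (class_size_nonneg n (lab n th E) (fst p)).
      pose proof (class_size_nonneg n (lab n th E) (snd p)); nra. }
    apply Rle_trans with (1 := uniform_pair_bound _ _ _ k Hpos H2).
    rewrite Rmult_comm; apply Rmult_le_compat_r; [apply pos_INR|].
    rewrite length_pairs; fold (count (has_degree 1 E) (seq 0 n)).
    set (a := INR (count (has_degree 1 E) (seq 0 n))) in *.
    pose proof (sumf_pairs_mult (class_size n (lab n th E))
                  (filter (has_degree 1 E) (seq 0 n))) as HS.
    fold (leaf_gain n th E) in HS.
    pose proof (leaf_class_size n th E HF) as HL.
    set (s := sumf (class_size n (lab n th E)) _) in *.
    assert (Hs : 0 <= s) by (apply sumf_nonneg; intros; apply class_size_nonneg).
    assert (Hss : s * s <= 4 * (INR n * INR n)) by nra.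
    assert (Ha : th * th <= 2 * (a * (a - 1))) by nra.
    apply Rmult_le_reg_r with (a * (a - 1) / 2); [nra|].
    unfold Rdiv at 1; rewrite Rmult_assoc, Rinv_l by nra; rewrite Rmult_1_r.
    apply Rle_trans with (4 * (INR n * INR n)); [exact (Rle_trans _ _ _ HS Hss)|].
    replace (4 * (INR n * INR n)) with (16 / (gam * gam) * (th * th / 4))
      by (rewrite Eth; field; lra).
    apply Rmult_le_compat_l; lra. }
  eapply Rle_trans.
  { apply mean_le; intros S HS; apply (potential_mean_pair n th K k E S HF HS). }
  rewrite 2!mean_plus, 2!mean_scal.
  pose proof (mean_const_le (potential n th K E + 2) (subsets (seq 0 n) k) ltac:(lra)).
  assert (2 * (K * K) * mean (fun S => ind (Nat.leb (count (frequent n th E) S) 1))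
                   (subsets (seq 0 n) k) <= 4 * (K * K) / (gam * INR (S k))).
  { replace (4 * (K * K) / (gam * INR (S k))) with (2 * (K * K) * (2 / (gam * INR (S k))))
      by (field; lra).
    apply Rmult_le_compat_l; lra. }
  lra.
Qed.

(** * Expectations along the process *)

Definition expect (D : distr) (f : graph -> R) : R := sumf (fun wE => fst wE * f (snd wE)) D.

(** Conditioning on the current graph: the two divisions in the weight are two nested uniform
    averages. *)
Lemma expect_step n kn D f :
  expect (drv_step n kn D) f
  = expect D (fun E => mean (fun S => mean (fun p => f (p :: E)) (pairs (chosen_set E S)))
                            (subsets (seq 0 n) kn)).
Proof.
  unfold expect, drv_step; rewrite sumf_flat_map; apply sumf_ext; intros [w E] _; cbn [fst snd].
  rewrite sumf_flat_map; unfold mean at 1, Rdiv; rewrite (Rmult_comm (sumf _ _)), <- !sumf_scal.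
  apply sumf_ext; intros S _; rewrite sumf_map; unfold mean, Rdiv; cbn [fst snd].
  rewrite (Rmult_comm (sumf _ _)), <- !sumf_scal; apply sumf_ext; intros p _; ring.
Qed.

Lemma drv_support n kn th t wE : In wE (drv_dist n kn t) ->
  0 <= fst wE /\ linear_forest n th (snd wE) /\ length (snd wE) = t.
Proof.
  revert wE; induction t as [|t IH]; intros wE.
  - intros [<-|[]]; split; [simpl; lra|split; [apply linear_forest_nil|reflexivity]].
  - cbn [drv_dist]; unfold drv_step; intros H.
    apply in_flat_map in H as ([w E] & HE & H).
    apply in_flat_map in H as (S & HS & H).
    apply in_map_iff in H as (p & <- & Hp).
    destruct (IH _ HE) as (Hw & HF & Hl); cbn [fst snd] in *.
    split; [|split; [|simpl; lia]].
    + assert (Hinv : forall m, 0 <= / INR m).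
      { intros [|m]; [simpl; rewrite Rinv_0; lra|].
        left; apply Rinv_0_lt_compat, lt_0_INR; lia. }
      unfold Rdiv; repeat apply Rmult_le_pos; auto.
    + destruct (in_pairs_chosen _ _ _ _ _ HS Hp) as (H1 & H2 & H3).
      destruct p; apply linear_forest_cons; auto.
Qed.

(** A step without an admissible set or pair loses mass, hence an inequality, which suffices for
    upper bounds. *)
Lemma drv_mass n kn t : expect (drv_dist n kn t) (fun _ => 1) <= 1.
Proof.
  induction t as [|t IH]; [unfold expect; simpl; lra|].
  cbn [drv_dist]; rewrite expect_step; apply Rle_trans with (2 := IH).
  apply sumf_le; intros wE H; apply (drv_support n kn 0) in H as (Hw & _).
  apply Rmult_le_compat_l; [exact Hw|].
  apply mean_le_const; [lra|]; intros S _; apply mean_const_le; lra.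
Qed.

(** Initially there is no bad edge and all classes are singletons, giving [K * K + INR n]; each step
    then adds at most the one-step drift. *)
Lemma expect_potential n gam K kn t :
  0 < gam <= 1 -> 2 <= gam * INR n -> 2 * (gam * INR n) + INR t <= INR n ->
  expect (drv_dist n kn t) (potential n (gam * INR n) K)
  <= K * K + INR n
     + INR t * (2 + 4 * (K * K) / (gam * INR (S kn)) + 16 / (gam * gam)).
Proof.
  intros Hg Hth; set (al := 2 + _ + _).
  assert (Hal : 0 <= al).
  { unfold al; assert (0 < INR (S kn)) by (apply lt_0_INR; lia).
    pose proof (Rle_0_sqr K) as HK; unfold Rsqr in HK.
    assert (0 <= 4 * (K * K) / (gam * INR (S kn)))
      by (apply Rmult_le_pos; [lra|apply Rlt_le, Rinv_0_lt_compat; nra]).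
    assert (0 < 16 / (gam * gam)) by (apply Rdiv_lt_0_compat; nra); lra. }
  induction t as [|t IH]; intros Ht.
  - unfold expect, potential, energy; simpl; rewrite (sumf_ext _ (fun _ => 1)).
    + rewrite sumf_const, length_seq; lra.
    + intros x Hx; apply (isolated_class_size n 0 []); auto using linear_forest_nil.
  - rewrite S_INR in *; cbn [drv_dist]; rewrite expect_step.
    apply Rle_trans with (expect (drv_dist n kn t) (potential n (gam * INR n) K)
                          + al * expect (drv_dist n kn t) (fun _ => 1)).
    + unfold expect; rewrite <- sumf_scal, <- sumf_plus; apply sumf_le; intros wE H.
      apply (drv_support n kn (gam * INR n)) in H as (Hw & HF & Hl).
      apply Rle_trans with (fst wE * (potential n (gam * INR n) K (snd wE) + al)); [|lra].
      apply Rmult_le_compat_l; [exact Hw|].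
      apply potential_mean_step; auto; rewrite Hl; lra.
    + pose proof (drv_mass n kn t); specialize (IH ltac:(lra)); nra.
Qed.

(** * Choice of constants and Markov's inequality *)

Lemma fold_right_map_sumf {A} (f : A -> R) l : fold_right Rplus 0 (map f l) = sumf f l.
Proof. induction l as [|x l IH]; simpl; [|rewrite IH]; reflexivity. Qed.

Lemma floorN_le x : 0 <= x -> INR (floorN x) <= x.
Proof.
  intros Hx; unfold floorN; destruct (base_Int_part x) as [H1 H2].
  (* The integer part is nonnegative, so [Z.to_nat] does not truncate it. *)
  assert (Hz : (-1 < Int_part x)%Z) by (apply lt_IZR; lra).
  rewrite INR_IZR_INZ, Z2Nat.id by lia; exact H1.
Qed.

Lemma eventually_INR_ge (x : R) : exists N : nat, forall n, (N <= n)%nat -> x <= INR n.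
Proof.
  exists (Z.to_nat (up x)); intros n Hn.
  destruct (archimed x) as [H _]; apply le_INR in Hn; rewrite INR_IZR_INZ in Hn.
  assert (IZR (up x) <= IZR (Z.of_nat (Z.to_nat (up x)))) by (apply IZR_le; lia); lra.
Qed.

Theorem theorem1 (k : nat -> nat)
  (Hk : forall n : nat, (2 <= n)%nat -> (2 <= k n <= n)%nat)
  (Hinf : forall M : nat, exists N : nat, forall n : nat, (N <= n)%nat -> (M <= k n)%nat)
  (Hlog : exists c : R, 0 < c /\ exists N : nat,
            forall n : nat, (N <= n)%nat -> c * ln (INR n) <= INR (k n))
  (d : R) (Hd : 0 < d < 1) :
  forall eps : R, 0 < eps ->
  forall delta : R, 0 < delta ->
  exists N : nat, forall n : nat, (N <= n)%nat ->
    drv_prob n (k n) (floorN (d * INR n))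
      (fun E => if Rle_dec (INR (largest_comp n%nat E)) (eps * INR n) then false else true)
    <= delta.
Proof.
  intros eps Heps delta Hdelta; clear Hk Hlog.
  (* This makes [2 * gam * n + t <= n] for all [t <= d * n]. *)
  set (gam := (1 - d) / 2).
  assert (Hg : 0 < gam <= 1) by (unfold gam; lra).
  assert (H16 : 0 < 16 / (gam * gam)) by (apply Rdiv_lt_0_compat; nra).
  (* The constant part of the drift, [2 + 16 / (gam * gam)], plus 1 for the initial energy [n]. Then
     [K] makes [c0 * n] one third of the Markov target [K * eps * n * delta]. *)
  set (c0 := 3 + 16 / (gam * gam)).
  assert (Hc0 : 0 < c0) by (unfold c0; lra).
  set (K := 3 * c0 / (eps * delta)).
  assert (HK : 0 < K) by (apply Rdiv_lt_0_compat; nra).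
  (* The three thresholds ensure [2 <= gam * n], then that [K * K] is at most a third of the target,
     then that the bad-edge term [be * n] is. *)
  destruct (eventually_INR_ge (2 / gam)) as [N1 HN1].
  destruct (eventually_INR_ge (3 * K / (eps * delta))) as [N2 HN2].
  destruct (eventually_INR_ge (12 * K / (gam * eps * delta))) as [M HM].
  destruct (Hinf M) as [N3 HN3].
  exists (N1 + N2 + N3)%nat; intros n Hn.
  specialize (HN1 n ltac:(lia)); specialize (HN2 n ltac:(lia)); specialize (HN3 n ltac:(lia)).
  apply HM in HN3; clear HM Hinf Hn.
  assert (Hth : 2 <= gam * INR n).
  { apply (Rmult_le_compat_l gam) in HN1; [|lra].
    replace (gam * (2 / gam)) with 2 in HN1 by (field; lra); exact HN1. }
  assert (Hn : 0 < INR n) by nra.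
  set (t := floorN (d * INR n)).
  assert (Ht : INR t <= d * INR n) by (apply floorN_le; nra).
  pose proof (expect_potential n gam K (k n) t Hg Hth ltac:(unfold gam; lra)) as HE.
  set (be := 4 * (K * K) / (gam * INR (S (k n)))) in *.
  assert (Hk : 0 < INR (S (k n))) by (apply lt_0_INR; lia).
  assert (Hbe0 : 0 <= be) by (apply Rlt_le, Rdiv_lt_0_compat; nra).
  (* Markov's inequality: a component larger than [eps * n] forces the potential above
     [K * eps * n]. *)
  assert (Hp : K * eps * INR n * drv_prob n (k n) t
      (fun E => if Rle_dec (INR (largest_comp n%nat E)) (eps * INR n) then false else true)
    <= expect (drv_dist n (k n) t) (potential n (gam * INR n) K)).
  { unfold drv_prob, expect.
    rewrite fold_right_map_sumf.
    rewrite <- sumf_scal; apply sumf_le; intros wE H.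
    apply (drv_support n (k n) (gam * INR n)) in H as (Hw & _).
    pose proof (potential_nonneg n (gam * INR n) K (snd wE)).
    pose proof (largest_comp_potential n (gam * INR n) K (snd wE) ltac:(lra)).
    destruct (Rle_dec _ _) as [h|h]; [nra|].
    rewrite Rmult_comm; apply Rmult_le_compat_l; [exact Hw|]; nra. }
  assert (HK1 : 3 * c0 = K * eps * delta) by (unfold K; field; lra).
  clearbody K.
  assert (HK2 : 3 * K <= INR n * eps * delta).
  { apply (Rmult_le_compat_r (eps * delta)) in HN2; [|nra].
    replace (3 * K / (eps * delta) * (eps * delta)) with (3 * K) in HN2 by (field; lra); lra. }
  assert (HK3 : 3 * be <= K * eps * delta).
  { apply Rmult_le_reg_r with (gam * INR (S (k n))); [nra|].
    unfold be; replace (3 * (4 * (K * K) / (gam * INR (S (k n)))) * (gam * INR (S (k n))))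
      with (12 * K * K) by (field; lra).
    apply (Rmult_le_compat_r (gam * eps * delta)) in HN3; [|apply Rlt_le; repeat apply Rmult_lt_0_compat; lra].
    replace (12 * K / (gam * eps * delta) * (gam * eps * delta)) with (12 * K) in HN3
      by (field; lra).
    assert (12 * K <= INR (S (k n)) * (gam * eps * delta)).
    { rewrite S_INR; assert (0 < gam * eps * delta) by (repeat apply Rmult_lt_0_compat; lra); lra. }
    nra. }
  apply Rmult_le_reg_l with (K * eps * INR n); [repeat apply Rmult_lt_0_compat; lra|].
  apply Rle_trans with (1 := Hp), Rle_trans with (1 := HE).
  (* Since [d < 1], [t] is replaced by [n]; the three thirds then add up to the target. *)
  apply Rle_trans with (K * K + INR n + INR n * (2 + be + 16 / (gam * gam))).
  { apply Rplus_le_compat_l, Rmult_le_compat_r; [lra|].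
    apply Rle_trans with (1 := Ht); nra. }
  apply Rle_trans with (K * K + INR n * (c0 + be)); [right; unfold c0, Rdiv; ring|].
  nra.
Qed.
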